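(* Let $X,Y$ be Banach spaces and let $u:\mathbb{R}_{\ge 0}\to\mathcal{L}(X;Y)$ be a function. Then the following are equivalent: (a) for each $x\in X$ there is $t_x\ge 0$ such that the orbit $u_x$ is uniformly continuous on $(t_x,\infty)$; (b) there is $t\ge 0$ such that for all $x\in X$ the orbit $u_x$ is uniformly continuous on $(t,\infty)$.
   Context: $X,Y$ are Banach spaces over the same field $\mathbb{R}$ or $\mathbb{C}$; $\mathcal{L}(X;Y)$ is the space of bounded linear operators from $X$ to $Y$; $\mathbb{R}_{\ge 0}=[0,\infty)$. No continuity or other regularity of $u$ is assumed. For $x\in X$, the orbit is the function $u_x:\mathbb{R}_{\ge 0}\to Y$, $u_x(t)=u(t)x$. *)

(* Defs.v *)
From HB Require Import structures.
From mathcomp Require Import all_boot all_order all_algebra.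
From mathcomp Require Import complex.
From mathcomp Require Import all_classical all_reals all_analysis.

Set Implicit Arguments.
Unset Strict Implicit.
Unset Printing Implicit Defensive.

Import Order.TTheory GRing.Theory Num.Theory.
Import numFieldNormedType.Exports.

Local Open Scope classical_set_scope.
Local Open Scope ring_scope.

(* For linear [f], boundedness near 0 is the existence of a constant [M] such
   that `|f x| <= M * `|x| for all [x] (linear_boundedP). *)
Record bounded_operator (K : numFieldType) (X Y : normedModType K) :=
  BoundedOperator {
    bounded_operator_linear :> {linear X -> Y} ;
    bounded_operatorP : bounded_near bounded_operator_linear (nbhs (0 : X)) }.

(* Used as a subtype of [R], with the uniform structure induced from [R]. *)
Definition Rge0 (R : realType) : set R := `[0, +oo[.
Arguments Rge0 : clear implicits.

Definition Rgt (R : realType) (t : R) : set (Rge0 R) :=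
  [set s : Rge0 R | t < set_val s].

Definition operator_orbit (R : realType) (K : numFieldType) (X Y : normedModType K)
    (u : Rge0 R -> bounded_operator X Y) (x : X) : Rge0 R -> Y :=
  fun t => u t x.

(* The restriction of [f] to the subtype [A] is uniformly continuous for the
   induced uniform structure; thus only pairs of points of [A] are compared. *)
Definition unif_continuous_on (T U : uniformType) (A : set T) (f : T -> U) :=
  unif_continuous (sigL A f).

(* Main.v *)
Require Import Defs.
From HB Require Import structures.
From mathcomp Require Import all_boot all_order all_algebra.
From mathcomp Require Import complex.
From mathcomp Require Import all_classical all_reals all_analysis.

Set Implicit Arguments.
Unset Strict Implicit.
Unset Printing Implicit Defensive.

Import Order.TTheory GRing.Theory Num.Theory.
Import numFieldNormedType.Exports.

Local Open Scope classical_set_scope.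
Local Open Scope ring_scope.

(** Write [X] as the increasing union of the subspaces [V_n] of those [x] whose
    orbit is uniformly continuous on the points beyond [n]. If each [V_n] were
    closed, Baire's theorem would give a [V_n] with an interior point, and a
    subspace with an interior point is the whole space. The [V_n] need not be
    closed in general, so the category argument is made twice.

    The first use concerns the oscillation at one fixed scale: the set [A_n] of
    those [x] with [`|u s x - u s' x| <= 1] for all [s, s' > n] at distance less
    than [1/(n+1)] is closed, because each [u s] is continuous, and the [A_n]
    cover [X] by uniform continuity with [epsilon = 1]. So some [A_n] contains a
    ball, which by linearity bounds the differences [u s - u s'] uniformly over
    all these pairs of points ([equibounded_oscillation]). Under such a bound, the
    set of vectors with uniformly continuous orbit beyond [m] is closed for every
    [m >= n], by approximation ([closed_unif_continuous_beyond]), and Baire's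
    theorem applies to these sets.

    Both real and complex scalars enter only through the sequence [1/(n+1)], which
    gets below every positive scalar; this gives Baire's theorem in the form of
    [baire_closed_cover]. *)

(** * Baire's theorem over an archimedean field of scalars *)

Lemma archimedean_real (R : realType) (e : R) : 0 < e ->
  exists n, n.+1%:R^-1 < e.
Proof.
by move=> e0; have [n] := ltr_add_invr e0; rewrite add0r => ne; exists n.
Qed.

Lemma archimedean_complex (R : realType) (e : R[i]) : 0 < e ->
  exists n, n.+1%:R^-1 < e.
Proof.
case: e => a b; rewrite ltcE /= => /andP[/eqP -> a0].
have [n na] := archimedean_real a0; exists n.
by rewrite -(rmorph_nat (real_complex R)) -fmorphV ltcE /= eqxx.
Qed.

Lemma pos_le_both (K : numFieldType) (a b : K) : 0 < a -> 0 < b ->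
  exists2 c, 0 < c & c <= a /\ c <= b.
Proof.
move=> a0 b0; have [ab|/ltW ba] := real_leP (gtr0_real a0) (gtr0_real b0).
  by exists a.
by exists b.
Qed.

Lemma closed_norm_le (K : numFieldType) (V : normedModType K) (r : K) :
  closed [set y : V | `|y| <= r].
Proof.
move=> y cly; apply/ler_addgt0Pr => e e0.
have [z [/= zr]] : [set y : V | `|y| <= r] `&` ball y e !=set0.
  by apply: cly; exact: nbhsx_ballx.
rewrite -ball_normE /= => yz.
by rewrite -[y](subrK z) addrC (le_trans (ler_normD _ _))// lerD// ltW.
Qed.

(** If no [A n] contained a ball, each closed [A n] could be avoided inside any
    given ball, and nested balls would converge to a point outside every [A n].
    The hypothesis on [K] makes the radii [1/(n+1)] of the nested balls tend to
    0; the order of [K] is only partial, as for the complex numbers. *)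
Lemma baire_closed_cover (K : numFieldType)
    (archiK : forall e : K, 0 < e -> exists n, n.+1%:R^-1 < e)
    (X : completeNormedModType K) (A : nat -> set X) :
  (forall n, closed (A n)) -> (forall x, exists n, A n x) ->
  exists n x r, 0 < r /\ ball x r `<=` A n.
Proof.
move=> clA covA; apply: contrapT => noball.
have shrink (p : nat * (X * {posnum K})) : exists q : X * {posnum K},
    (forall z, `|q.1 - z| <= q.2%:num -> `|p.2.1 - z| < p.2.2%:num /\ ~ A p.1 z)
    /\ q.2%:num <= p.1.+1%:R^-1.
  case: p => n [x r] /=.
  have [y [xy Ay]] : exists y, ball x r%:num y /\ ~ A n y.
    apply: contrapT => nex; apply: noball; exists n, x, r%:num; split=> // y xy.
    by apply: contrapT => nAy; apply: nex; exists y.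
  have : nbhs y (ball x r%:num `&` ~` A n).
    apply: open_nbhs_nbhs; split => //.
    by apply: openI; [exact: ball_open | exact: closed_openC].
  move=> /nbhs_ballP[d /= d0]; rewrite -!ball_normE => dsub.
  have [c c0 [cd cn]] : exists2 c : K, 0 < c & c <= d / 2 /\ c <= n.+1%:R^-1.
    by apply: pos_le_both; rewrite ?divr_gt0.
  exists (y, PosNum c0); split => //= z yz; apply: dsub => /=.
  apply: le_lt_trans yz _; apply: le_lt_trans cd _.
  by rewrite ltr_pdivrMr// ltr_pMr// ltr1n.
have [f fP] := choice shrink.
(* The ball [b n.+1] is inside [b n] and avoids [A n], so the common limit of the
   centres lies in no [A n]. *)
pose fix b n := if n is m.+1 then f (m, b m) else (0, PosNum ltr01).
have bS n z : `|(b n.+1).1 - z| <= (b n.+1).2%:num ->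
    `|(b n).1 - z| < (b n).2%:num /\ ~ A n z by have [+ _] := fP (n, b n); exact.
have br n : (b n.+1).2%:num <= n.+1%:R^-1 by have [] := fP (n, b n).
have nest n m z : (n <= m)%N -> `|(b m).1 - z| <= (b m).2%:num ->
    `|(b n).1 - z| <= (b n).2%:num.
  elim: m => [|m IH]; first by rewrite leqn0 => /eqP->.
  rewrite leq_eqVlt => /predU1P[->//|nm] /bS[/ltW bz _]; exact: IH.
have bb n m : (n <= m)%N -> `|(b n).1 - (b m).1| <= (b n).2%:num.
  by move=> /nest; apply; rewrite subrr normr0.
have : cvg ((fun n => (b n).1) @ \oo).
  apply: cauchy_cvg; apply: cauchy_exP => e e0.
  have [n ne] := archiK e e0.
  exists (b n.+1).1; exists n.+1 => // m /= nm; rewrite -ball_normE /=.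
  exact: le_lt_trans (bb _ _ nm) (le_lt_trans (br n) ne).
move=> /cvg_ex[l /cvgrPdist_lt bl].
have lball n : `|(b n).1 - l| <= (b n).2%:num.
  apply/ler_addgt0Pr => e e0; have [N _ NP] := bl e e0.
  have /NP/ltW /= le_e : (N <= maxn N n)%N by rewrite leq_maxl.
  rewrite -[_ - l](subrKA (b (maxn N n)).1) (le_trans (ler_normD _ _))// lerD//.
    by apply: bb; rewrite leq_maxr.
  by rewrite distrC.
have [n Anl] := covA l.
by have [_] := bS n l (lball n.+1); exact.
Qed.

(** * Oscillation of an orbit at a given scale *)

Section oscillation.
Variables (R : realType) (K : numFieldType) (X Y : normedModType K).
Variable u : Rge0 R -> bounded_operator X Y.

(** The bound [c] is not strict, so that these sets of vectors are closed. *)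
Definition oscillation_le (t d : R) (c : K) : set X :=
  [set x | forall s s' : Rge0 R, t < set_val s -> t < set_val s' ->
     `|set_val s - set_val s'| < d -> `|u s x - u s' x| <= c].

Definition unif_continuous_beyond (t : R) : set X :=
  [set x | forall c : K, 0 < c -> exists2 d, 0 < d & oscillation_le t d c x].

Lemma unif_continuous_beyondP t x :
  unif_continuous_on (Rgt t) (operator_orbit u x) <->
  unif_continuous_beyond t x.
Proof.
rewrite /unif_continuous_on /unif_continuous -!entourage_ballE; split.
  move=> xP c c0.
  have [d d0 dP] := xP _ (ex_intro2 _ _ c c0 (fun p cp => cp)).
  exists d => // s s' ts ts' ss'.
  pose p := SigSub (mem_set ts : s \in Rgt t).
  pose p' := SigSub (mem_set ts' : s' \in Rgt t).
  have := dP (p, p') ss'.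
  by rewrite /= -ball_normE; exact: ltW.
move=> xP E [e /= e0 eE].
have [d d0 dP] := xP (e / 2) (divr_gt0 e0 (ltr0n _ 2)).
exists d => //= -[s s'] /= ss'; apply: eE => /=.
rewrite -ball_normE /=; apply: (@le_lt_trans _ _ (e / 2)).
  by apply: dP => //; [exact: (set_valP s)|exact: (set_valP s')].
by rewrite ltr_pdivrMr// ltr_pMr// ltr1n.
Qed.

Lemma oscillation_leW t t' d d' (c c' : K) : t <= t' -> d' <= d -> c <= c' ->
  oscillation_le t d c `<=` oscillation_le t' d' c'.
Proof.
move=> tt' d'd cc' x xP s s' ts ts' ss'; apply: le_trans cc'.
by apply: xP; [exact: le_lt_trans ts|exact: le_lt_trans ts'|exact: lt_le_trans d'd].
Qed.

Lemma oscillation_leD t d (a b : K) x y : oscillation_le t d a x ->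
  oscillation_le t d b y -> oscillation_le t d (a + b) (x + y).
Proof.
move=> xP yP s s' ts ts' ss'; rewrite 2!linearD opprD addrACA.
by rewrite (le_trans (ler_normD _ _))// lerD//; [exact: xP|exact: yP].
Qed.

Lemma oscillation_leZ t d (c a : K) x :
  oscillation_le t d c x -> oscillation_le t d (`|a| * c) (a *: x).
Proof.
move=> xP s s' ts ts' ss'; rewrite 2!linearZ_LR -scalerBr normrZ.
by rewrite ler_wpM2l//; exact: xP.
Qed.

Lemma closed_oscillation_le t d (c : K) : closed (oscillation_le t d c).
Proof.
have -> : oscillation_le t d c =
    \bigcap_(p in [set p : Rge0 R * Rge0 R | [/\ t < set_val p.1,
        t < set_val p.2 & `|set_val p.1 - set_val p.2| < d]])
      ((fun x => u p.1 x - u p.2 x) @^-1` [set y | `|y| <= c]).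
  apply/seteqP; split=> x xP; first by move=> [s s'] [/= ? ? ?]; exact: xP.
  by move=> s s' ? ? ?; exact: (xP (s, s')).
apply: closed_bigI => -[s s'] _; apply: preimage_closed (@closed_norm_le _ _ c).
move=> x _; apply: continuousB;
  exact: bounded_linear_continuous (bounded_operatorP _) _.
Qed.

Lemma unif_continuous_beyondW t t' : t <= t' ->
  unif_continuous_beyond t `<=` unif_continuous_beyond t'.
Proof.
move=> tt' x xP c /xP[d d0 xd]; exists d => //.
exact: oscillation_leW xd.
Qed.

Lemma unif_continuous_beyondD t x y : unif_continuous_beyond t x ->
  unif_continuous_beyond t y -> unif_continuous_beyond t (x + y).
Proof.
move=> xP yP c c0; have c20 : 0 < c / 2 by rewrite divr_gt0.
have [d d0 xd] := xP _ c20; have [e e0 ye] := yP _ c20.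
exists (Num.min d e); first by rewrite lt_min d0.
rewrite [c]splitr; apply: oscillation_leD.
  by apply: oscillation_leW xd; rewrite ?ge_min ?lexx.
by apply: oscillation_leW ye; rewrite ?ge_min ?lexx ?orbT.
Qed.

Lemma unif_continuous_beyondZ t (a : K) x :
  unif_continuous_beyond t x -> unif_continuous_beyond t (a *: x).
Proof.
move=> xP c c0; have a0 : 0 < `|a| + 1 by rewrite ltr_wpDl.
have [d d0 xd] := xP (c / (`|a| + 1)) (divr_gt0 c0 a0).
exists d => //; move: (oscillation_leZ a xd); apply: oscillation_leW => //.
by rewrite mulrCA ler_piMr ?(ltW c0)// ler_pdivrMr// mul1r lerDl.
Qed.

(** A subspace with an interior point [x] is the whole space: [x + a *: y] lies in
    the ball for a small [a > 0], and [y] is a combination of it and [x]. *)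
Lemma unif_continuous_beyond_ball t x r : 0 < r ->
  ball x r `<=` unif_continuous_beyond t -> unif_continuous_beyond t = setT.
Proof.
move=> r0 xr; apply/seteqP; split=> // y _.
have y0 : 0 < `|y| + 1 by rewrite ltr_wpDl.
have a0 : 0 < r / (`|y| + 1) by rewrite divr_gt0.
set a := r / _ in a0.
have -> : y = a^-1 *: ((x + a *: y) + (-1) *: x).
  by rewrite scaleN1r addrAC subrr add0r scalerA mulVf ?gt_eqF// scale1r.
apply/unif_continuous_beyondZ/unif_continuous_beyondD.
  apply: xr; rewrite -ball_normE /= opprD addrA subrr add0r normrN normrZ.
  by rewrite gtr0_norm// /a mulrAC -mulrA gtr_pMr// ltr_pdivrMr// mul1r ltrDl.
by apply/unif_continuous_beyondZ/xr; exact: ballxx.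
Qed.

(** [x] near [y] in the set gives [x = y + (x - y)], and the common bound makes
    the oscillation of the orbit of [x - y] small at the fixed scale [d]. *)
Lemma closed_unif_continuous_beyond t d (c r : K) : 0 < d -> 0 < c -> 0 < r ->
  ball 0 r `<=` oscillation_le t d c -> closed (unif_continuous_beyond t).
Proof.
move=> d0 c0 r0 rP x clx e e0; have e20 : 0 < e / 2 by rewrite divr_gt0.
pose a := (e / 2) / c; have a0 : 0 < a by rewrite divr_gt0.
have [y [yP]] : unif_continuous_beyond t `&` ball x (a * r) !=set0.
  by apply: clx; apply: nbhsx_ballx; rewrite mulr_gt0.
rewrite -ball_normE /= => xy; have [d' d'0 yd'] := yP _ e20.
exists (Num.min d d'); first by rewrite lt_min d0.
rewrite [e]splitr -[x](subrK y); apply: oscillation_leD; last first.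
  by apply: oscillation_leW yd'; rewrite ?ge_min ?lexx ?orbT.
have : oscillation_le t d c (a^-1 *: (x - y)).
  apply: rP; rewrite -ball_normE /= sub0r normrN normrZ gtr0_norm ?invr_gt0//.
  by rewrite ltr_pdivrMl.
move=> /(oscillation_leZ a); rewrite scalerA mulfV ?gt_eqF// scale1r.
apply: oscillation_leW; rewrite ?ge_min ?lexx//.
by rewrite gtr0_norm// /a divfK// gt_eqF.
Qed.

End oscillation.

(** * The two applications of Baire's theorem *)

Section baire_orbits.
Variables (R : realType) (K : numFieldType).
Hypothesis archiK : forall e : K, 0 < e -> exists n, n.+1%:R^-1 < e.
Variables (X : completeNormedModType K) (Y : normedModType K).
Variable u : Rge0 R -> bounded_operator X Y.
Hypothesis uc : forall x : X, exists t, unif_continuous_beyond u t x.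

(** Baire's theorem is applied to the vectors whose orbit oscillates by at most 1
    at the scale [1/(n+1)] beyond [n]. The bound becomes 2 because a point of the
    ball at the origin is a difference of two points of the ball obtained. *)
Lemma equibounded_oscillation : exists (n : nat) (d : R) (r : K),
  [/\ 0 < d, 0 < r & ball 0 r `<=` oscillation_le u n%:R d 2].
Proof.
have cov x : exists n, oscillation_le u n%:R n.+1%:R^-1 1 x.
  have [t /(_ 1 ltr01)[d d0 xd]] := uc x.
  (* The first entry exceeds [t], the second makes the scale at most [d]. *)
  exists (maxn (Num.truncn t).+1 (Num.truncn d^-1).+1).
  apply: oscillation_leW xd => //.
    by rewrite (le_trans (ltW (truncnS_gt _)))// ler_nat leq_maxl.
  rewrite -[leRHS]invrK lef_pV2 ?posrE ?invr_gt0//.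
  by rewrite (le_trans (ltW (truncnS_gt _)))// ler_nat ltnW// ltnS leq_maxr.
have [n [x [r [r0 xr]]]] :=
  baire_closed_cover archiK (fun n => @closed_oscillation_le _ _ _ _ u _ _ _) cov.
exists n, n.+1%:R^-1, r; split => // z; rewrite -ball_normE /= sub0r normrN => zr.
have -> : z = (x + z) + (-1) *: x by rewrite scaleN1r addrAC subrr add0r.
apply: oscillation_leD.
  by apply: xr; rewrite -ball_normE /= opprD addrA subrr add0r normrN.
have /(oscillation_leZ (-1)) := xr x (ballxx _ r0).
by rewrite normrN1 mul1r.
Qed.

Lemma unif_continuous_beyond_common :
  exists2 t, 0 <= t & unif_continuous_beyond u t = setT.
Proof.
have [n [d [r [d0 r0 rP]]]] := equibounded_oscillation.
have clV k : closed (unif_continuous_beyond u (n + k)%:R).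
  apply: (@closed_unif_continuous_beyond _ _ _ _ u _ d 2 r) => //.
  by move=> z /rP; apply: oscillation_leW; rewrite // ler_nat leq_addr.
have cov x : exists k, unif_continuous_beyond u (n + k)%:R x.
  have [t xt] := uc x; exists (Num.truncn t).+1; apply: unif_continuous_beyondW xt.
  by rewrite (le_trans (ltW (truncnS_gt _)))// ler_nat leq_addl.
have [k [x [s [s0 xs]]]] := baire_closed_cover archiK clV cov.
by exists (n + k)%:R => //; exact: unif_continuous_beyond_ball xs.
Qed.

End baire_orbits.

Theorem proposition3p7 (R : realType) (K : numFieldType)
    (hK : K = (R : numFieldType) \/ K = (R[i] : numFieldType))
    (X Y : completeNormedModType K)
    (u : Rge0 R -> bounded_operator X Y) :
  (forall x : X, exists2 t : R, 0 <= t &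
     unif_continuous_on (Rgt t) (operator_orbit u x)) <->
  (exists2 t : R, 0 <= t &
     forall x : X, unif_continuous_on (Rgt t) (operator_orbit u x)).
Proof.
split=> [uc|[t t0 tP] x]; last by exists t.
have archiK (e : K) : 0 < e -> exists n, n.+1%:R^-1 < e.
  by case: hK e => ->; [exact: archimedean_real|exact: archimedean_complex].
have [x|t t0 tT] := unif_continuous_beyond_common archiK (u := u).
  by have [t _ /unif_continuous_beyondP] := uc x; exists t.
by exists t => // x; apply/unif_continuous_beyondP; rewrite tT.
Qed.
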